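(* Let $(V,\nu,\tau,\tau^* )$ be a metrizable PN space that is a topological vector space (with its strong topology). Then it is paranormable, i.e. there exists an $F$-norm $g$ on $V$ such that $(V,g)$ is a paranormed space and the topology of the metric $d(p,q)=g(p-q)$ is the strong topology.
   Context: $\mathbb{R}^+=[0,\infty)$. $\Delta^+$ is the set of distance distribution functions, i.e. nondecreasing functions $F:[-\infty,+\infty]\to[0,1]$, left-continuous on $\mathbb{R}$, with $F(0)=0$ and $F(+\infty)=1$, ordered pointwise. $\varepsilon_a(x)=0$ for $x\le a$ and $1$ for $x>a$. A triangle function is a map $\tau:\Delta^+\times\Delta^+\to\Delta^+$ that is commutative, associative, nondecreasing in each variable, and has $\varepsilon_0$ as identity. A PN space is a quadruple $(V,\nu,\tau,\tau^* )$ with $V$ a real vector space (null vector $\theta$), $\nu:V\to\Delta^+$, $p\mapsto\nu_p$, and $\tau,\tau^*$ triangle functions such that for all $p,q\in V$: (N1) $\nu_p=\varepsilon_0$ iff $p=\theta$; (N2) $\nu_{-p}=\nu_p$; (N3) $\nu_{p+q}\ge\tau(\nu_p,\nu_q)$; (N4) $\nu_p\le\tau^*(\nu_{\lambda p},\nu_{(1-\lambda)p})$ for every $\lambda\in[0,1]$. The strong topology has as neighborhood base at $q$ the sets $q+N_\theta(t)$, $t>0$, where $N_\theta(t)=\{p:\nu_p(t)>1-t\}$; the hypothesis means that these sets are neighborhood bases of a genuine metrizable topology making $V$ a topological vector space. An $F$-norm on $V$ is a map $g:V\to\mathbb{R}^+$ such that (i) $g(p)=0$ iff $p=\theta$; (ii)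 $g(\lambda p)\le g(p)$ if $|\lambda|\le1$; (iii) $g(p+q)\le g(p)+g(q)$. The pair $(V,g)$ is an $F$-normed space; it is called a paranormed space if it is a topological vector space for the metric $d(p,q)=g(p-q)$. *)

(* Defs.v *)
From HB Require Import structures.
From mathcomp Require Import all_boot all_order all_algebra.
From mathcomp Require Import all_classical all_reals all_analysis.

Set Implicit Arguments.
Unset Strict Implicit.
Unset Printing Implicit Defensive.

Import Order.TTheory GRing.Theory Num.Theory.
Import numFieldNormedType.Exports.

Local Open Scope classical_set_scope.
Local Open Scope ring_scope.

(* The set Delta^+ of distance distribution functions. *)
Record ddf (R : realType) := DDF {
  ddf_fun :> \bar R -> R ;
  ddf_itv : forall x, 0 <= ddf_fun x <= 1 ;
  ddf_nondecreasing : forall x y, (x <= y)%E -> ddf_fun x <= ddf_fun y ;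
  ddf_left_continuous : forall x : R,
    ddf_fun y%:E @[y --> x^'-] --> ddf_fun x%:E ;
  ddf_0 : ddf_fun 0%E = 0 ;
  ddf_pinfty : ddf_fun +oo%E = 1
}.

Definition ddf_le (R : realType) (F G : ddf R) := forall x, F x <= G x.

Definition eps_fun (R : realType) (a : R) (x : \bar R) : R :=
  if (x <= a%:E)%E then 0 else 1.

Section eps.
Variables (R : realType) (a : {nonneg R}).
Local Notation e := (eps_fun a%:num).

Let eps_itv x : 0 <= e x <= 1.
Proof. by rewrite /eps_fun; case: ifP; rewrite ?lexx ler01. Qed.

Let eps_nondecreasing x y : (x <= y)%E -> e x <= e y.
Proof.
move=> xy; rewrite /eps_fun; case: ifPn => xa; case: ifPn => ya //.
by rewrite (le_trans xy ya) in xa.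
Qed.

Let eps_left_continuous (x : R) : e y%:E @[y --> x^'-] --> e x%:E.
Proof.
apply: cvg_near_cst; rewrite /eps_fun lee_fin; have [xa|ax] := leP x a%:num.
  near=> y; rewrite lee_fin ifT//.
  have yx : y < x by near: y; exact: nbhs_left_lt.
  exact: (le_trans (ltW yx) xa).
by near=> y; rewrite lee_fin leNgt ifF//; apply/negbTE; rewrite negbK;
  near: y; exact: nbhs_left_gt.
Unshelve. all: by end_near.
Qed.

Let eps_0 : e 0%E = 0.
Proof. by rewrite /eps_fun lee_fin ifT. Qed.

Let eps_pinfty : e +oo%E = 1.
Proof. by rewrite /eps_fun. Qed.

Definition eps : ddf R :=
  DDF eps_itv eps_nondecreasing eps_left_continuous eps_0 eps_pinfty.

End eps.

Record triangle_function (R : realType) := TriangleFunction {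
  tf_fun :> ddf R -> ddf R -> ddf R ;
  tfC : commutative tf_fun ;
  tfA : associative tf_fun ;
  tf_le_l : forall F F' G, ddf_le F F' -> ddf_le (tf_fun F G) (tf_fun F' G) ;
  tf_le_r : forall F G G', ddf_le G G' -> ddf_le (tf_fun F G) (tf_fun F G') ;
  tf1 : forall F, tf_fun F (eps 0%:nng) = F
}.

Record pn_space (R : realType) (V : lmodType R) := PNSpace {
  pn_nu :> V -> ddf R ;
  pn_tau : triangle_function R ;
  pn_taustar : triangle_function R ;
  pn_N1 : forall p, pn_nu p = eps 0%:nng <-> p = 0 ;
  pn_N2 : forall p, pn_nu (- p) = pn_nu p ;
  pn_N3 : forall p q, ddf_le (pn_tau (pn_nu p) (pn_nu q)) (pn_nu (p + q)) ;
  pn_N4 : forall p (l : R), 0 <= l <= 1 ->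
    ddf_le (pn_nu p) (pn_taustar (pn_nu (l *: p)) (pn_nu ((1 - l) *: p)))
}.

Definition Ntheta (R : realType) (V : lmodType R) (nu : pn_space V) (t : R) :
  set V := [set p | 1 - t < nu p t%:E].

(* V equipped with its strong neighborhoods. For an arbitrary PN space these *)
(* need not come from a topology, hence only a nbhsType structure.           *)
Definition strong_space (R : realType) (V : lmodType R) (nu : pn_space V) :
  Type := V.

Section strong_space.
Variables (R : realType) (V : lmodType R) (nu : pn_space V).

HB.instance Definition _ := GRing.Lmodule.on (strong_space nu).

Definition strong_nbhs (q : V) : set_system V :=
  filter_from [set t : R | 0 < t] (fun t => [set q + p | p in Ntheta nu t]).

HB.instance Definition _ := hasNbhs.Build (strong_space nu) strong_nbhs.

End strong_space.

Record metric (R : realType) (V : lmodType R) := IsMetric {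
  metric_fun :> V -> V -> R ;
  metric_ge0 : forall p q, 0 <= metric_fun p q ;
  metric_eq0 : forall p q, metric_fun p q = 0 <-> p = q ;
  metric_symmetric : forall p q, metric_fun p q = metric_fun q p ;
  metric_triangular : forall p q r,
    metric_fun p r <= metric_fun p q + metric_fun q r
}.

Definition metric_space (R : realType) (V : lmodType R) (d : metric V) :
  Type := V.

Section metric_space.
Variables (R : realType) (V : lmodType R) (d : metric V).

HB.instance Definition _ := GRing.Lmodule.on (metric_space d).

Let dxx (p : metric_space d) : d p p = 0.
Proof. exact/metric_eq0. Qed.

Let d_eq (p q : metric_space d) : d p q = 0 -> p = q.
Proof. by move/metric_eq0. Qed.

Let d_triangle (q p r : metric_space d) : d p r <= d p q + d q r.
Proof. exact: metric_triangular. Qed.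

HB.instance Definition _ := @isMetric.Build R (metric_space d)
  (d : metric_space d -> metric_space d -> R)
  dxx d_eq (@metric_symmetric R V d) d_triangle.

End metric_space.

Definition induces_strong_topology (R : realType) (V : lmodType R)
    (nu : pn_space V) (d : metric V) : Prop :=
  forall p : V, nbhs (p : metric_space d) = nbhs (p : strong_space nu).

(* The topology axioms for the strong neighborhoods follow from d.           *)
Definition strongly_metrizable (R : realType) (V : lmodType R)
    (nu : pn_space V) : Prop :=
  exists d : metric V, induces_strong_topology nu d.

(* For a space whose neighborhoods already form a topology, these are the    *)
(* axioms of topologicalLmodType (continuity of the opposite follows).       *)
Definition is_tvs (R : realType) (W : NbhsLmodule.type R) : Prop :=
  continuous (fun x : W * W => x.1 + x.2) /\
  continuous (fun z : R^o * W => z.1 *: z.2).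

Record Fnorm (R : realType) (V : lmodType R) := FNorm {
  Fnorm_fun :> V -> R ;
  Fnorm_ge0 : forall p, 0 <= Fnorm_fun p ;
  Fnorm_eq0 : forall p, Fnorm_fun p = 0 <-> p = 0 ;
  Fnorm_scale : forall (l : R) p, `|l| <= 1 -> Fnorm_fun (l *: p) <= Fnorm_fun p ;
  Fnorm_triangle : forall p q, Fnorm_fun (p + q) <= Fnorm_fun p + Fnorm_fun q
}.

Section Fnorm_metric.
Variables (R : realType) (V : lmodType R) (g : Fnorm V).
Let d (p q : V) := g (p - q).

Let d_ge0 p q : 0 <= d p q.
Proof. exact: Fnorm_ge0. Qed.

Let d_eq0 p q : d p q = 0 <-> p = q.
Proof.
split=> [/Fnorm_eq0/eqP|->]; first by rewrite subr_eq0 => /eqP.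
by apply/Fnorm_eq0; rewrite subrr.
Qed.

Let d_sym p q : d p q = d q p.
Proof.
have gN r : g (- r) <= g r by rewrite -scaleN1r Fnorm_scale// normrN normr1.
by apply/eqP; rewrite /d eq_le -{1}(opprB q p) gN -{1}(opprB p q) gN.
Qed.

Let d_triangle p q r : d p r <= d p q + d q r.
Proof. by rewrite /d (le_trans _ (Fnorm_triangle _ _ _))// addrA subrK. Qed.

Definition Fnorm_metric : metric V := IsMetric d_ge0 d_eq0 d_sym d_triangle.

End Fnorm_metric.

Definition paranormed (R : realType) (V : lmodType R) (g : Fnorm V) : Prop :=
  is_tvs (metric_space (Fnorm_metric g)).

(* Main.v *)
Require Import Defs.
From HB Require Import structures.
From mathcomp Require Import all_boot all_order all_algebra.
From mathcomp Require Import all_classical all_reals all_analysis.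
From mathcomp Require Import lra.

(** The neighborhoods [Ntheta nu t] of the null vector are balanced: since every
    distance distribution function lies below the identity [eps 0] of a
    triangle function, (N4) and monotonicity of [pn_taustar nu] give
    [nu p <= taustar (nu (l *: p)) (eps 0) = nu (l *: p)] for [0 <= l <= 1], and
    (N2) extends this to [`|l| <= 1]. They shrink with [t], so those with
    [t = n.+1%:R^-1] form a countable base; they meet only at [0] by (N1); and
    continuity of the addition at [(0, 0)] gives, for each of them, a smaller
    one whose sum with itself it contains. It remains to produce an F-norm from
    such a base, which is a form of the Birkhoff-Kakutani theorem.

    The relations [y - x \in U n] are a countable base of a uniformity on [V],
    and a uniformity with a countable base is defined by a pseudometric. That
    pseudometric has no reason to respect the vector structure, but the
    uniformity does: it is invariant under translations and its base is
    balanced. So the pseudometric can be replaced by the largest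
    displacement that the multiples [l *: p], [`|l| <= 1], cause at any point
    [x]; this is [gauge p]. Taking all [x] into account makes [gauge]
    subadditive ([gaugeD]), taking all [l] into account makes it decrease under
    scaling ([gaugeZ]), and uniformity of the estimates means that nothing is
    lost topologically: [base_uball] and [uball_base] compare the sets
    [gauge p < e] with the base. Finally the F-norm metric has the strong
    neighborhoods ([gauge_induces_strong]), so the continuity of the vector
    operations carries over to it. *)

Set Implicit Arguments.
Unset Strict Implicit.
Unset Printing Implicit Defensive.

Import Order.TTheory GRing.Theory Num.Theory.
Import numFieldNormedType.Exports.

Local Open Scope classical_set_scope.
Local Open Scope ring_scope.

(** * F-norms from countable balanced bases *)

(** A countable base at [0] of a Hausdorff translation-invariant topology, made
    of balanced sets. *)
Record balanced_base (R : realType) (V : lmodType R) := BalancedBase {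
  base_set :> nat -> set V ;
  base0 : forall n, base_set n 0 ;
  base_decreasing : forall m n, (m <= n)%N -> base_set n `<=` base_set m ;
  base_balanced : forall n (l : R) p,
    `|l| <= 1 -> base_set n p -> base_set n (l *: p) ;
  base_half : forall n, exists m, forall p q,
    base_set m p -> base_set m q -> base_set n (p + q) ;
  base_separated : forall p, (forall n, base_set n p) -> p = 0
}.

(** A copy of [V] that depends on [U], to carry the uniformity defined by it. *)
Definition translation_space (R : realType) (V : lmodType R)
  (U : balanced_base V) : Type := V.

Section translation_space.
Variables (R : realType) (V : lmodType R) (U : balanced_base V).

HB.instance Definition _ := GRing.Lmodule.on (translation_space U).

Definition translation_entourage : set_system (V * V) :=
  filter_from setT (fun n => [set xy | U n (xy.2 - xy.1)]).

Let entourage_filter : Filter translation_entourage.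
Proof.
apply: filter_from_filter; first by exists 0%N.
move=> m n _ _; exists (maxn m n) => //= -[x y] /= Uxy.
by split; apply: base_decreasing Uxy; rewrite ?leq_maxl ?leq_maxr.
Qed.

Let entourage_diagonal A : translation_entourage A -> diagonal `<=` A.
Proof.
move=> [n _ nA] [x y] /= xy; apply: nA => /=.
by rewrite (xy : x = y) subrr; exact: base0.
Qed.

Let entourage_inv A :
  translation_entourage A -> translation_entourage (A^-1)%relation.
Proof.
move=> [n _ nA]; exists n => // -[x y] /= Uxy; apply: nA => /=.
by rewrite -opprB -scaleN1r; apply: base_balanced; rewrite // normrN normr1.
Qed.

Let entourage_split A : translation_entourage A ->
  exists2 B, translation_entourage B & (B \; B)%relation `<=` A.
Proof.
move=> [n _ nA]; have [m Um] := base_half U n.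
exists [set xy | U m (xy.2 - xy.1)]; first by exists m.
move=> [x z] [y /= Uxy Uyz]; apply: nA => /=.
have -> : z - x = (z - y) + (y - x) by rewrite addrA subrK.
exact: Um.
Qed.

HB.instance Definition _ := isUniform.Build (translation_space U)
  entourage_filter entourage_diagonal entourage_inv entourage_split.

Lemma translation_countable : countable_uniformity (translation_space U).
Proof.
apply/countable_uniformityP.
exists (fun n => [set xy | U n (xy.2 - xy.1)]); last by move=> n; exists n.
by move=> A [n _ nA]; exists n.
Qed.

(** This pseudometric is only known to define the right uniformity: its balls
    at different points are not translates of each other. *)
Definition translation_metrized : pseudoMetricType R :=
  countable_uniform translation_countable.

(** Quantifying over the points [x] makes up for the lack of translation
    invariance of the pseudometric, and quantifying over [l] makes these sets
    balanced. *)
Definition uball (e : R) (p : V) : Prop := forall (x : V) (l : R), `|l| <= 1 ->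
  ball (x : translation_metrized) e (x + l *: p : translation_metrized).

(** The pseudometric is bounded, so that the infimum defining [gauge] is over a
    nonempty set. *)
Lemma uball2 p : uball 2 p.
Proof. by move=> x l _; exact: countable_uniform.countable_uniform_bounded. Qed.

Lemma uball_le e f p : e <= f -> uball e p -> uball f p.
Proof. by move=> ef ep x l l1; apply: le_ball ef _ _; exact: ep. Qed.

Lemma uball0 e : 0 < e -> uball e 0.
Proof. by move=> e0 x l _; rewrite scaler0 addr0; exact: ballxx. Qed.

(** The displacement by [l *: q] starts from the point [x + l *: p]; this is why
    [uball] quantifies over all points. *)
Lemma uballD e f p q : uball e p -> uball f q -> uball (e + f) (p + q).
Proof.
move=> ep fq x l l1; rewrite scalerDr addrA.
exact: ball_triangle (ep x l l1) (fq _ l l1).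
Qed.

Lemma uballZ e (l : R) p : `|l| <= 1 -> uball e p -> uball e (l *: p).
Proof.
by move=> l1 ep x m m1; rewrite scalerA; apply: ep; rewrite normrM mulr_ile1.
Qed.

(** One [n] serves all points at once, the entourages being translation
    invariant, and all multiples of [p], as [U n] is balanced. *)
Lemma base_uball e : 0 < e -> exists n, U n `<=` uball e.
Proof.
move=> e0; have : @entourage translation_metrized
    [set xy : translation_metrized * translation_metrized | ball xy.1 e xy.2].
  by rewrite -entourage_ballE; exists e.
move=> [n _ nE]; exists n => p Up x l l1; apply: (nE (x, x + l *: p)) => /=.
by rewrite addrAC subrr add0r; exact: base_balanced.
Qed.

(** Here the displacement of the origin by [p] itself already suffices. *)
Lemma uball_base n : exists2 e, 0 < e & uball e `<=` U n.
Proof.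
have : @entourage translation_metrized [set xy | U n (xy.2 - xy.1)].
  by exists n.
rewrite -entourage_ballE => -[e /= e0 eU]; exists e => // p ep.
have /= := eU (0, p); rewrite subr0; apply.
by have := ep 0 1; rewrite normr1 scale1r add0r; apply.
Qed.

Definition gauge (p : V) : R := inf [set e | 0 < e /\ uball e p].

Let gauge_has_inf p : has_inf [set e | 0 < e /\ uball e p].
Proof.
split; first by exists 2; split => //; exact: uball2.
by exists 0 => e [/ltW].
Qed.

Lemma gauge_le e p : 0 < e -> uball e p -> gauge p <= e.
Proof. by move=> e0 ep; apply: ge_inf => //; case: (gauge_has_inf p). Qed.

Lemma gauge_lt e p : gauge p < e -> uball e p.
Proof.
move=> /(inf_lt (gauge_has_inf p).1) [f [_ fp] /ltW fe].
exact: uball_le fe fp.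
Qed.

Lemma gauge_ge0 p : 0 <= gauge p.
Proof.
by apply: lb_le_inf => [|e [/ltW]//]; case: (gauge_has_inf p).
Qed.

Lemma gauge_eq0 p : gauge p = 0 <-> p = 0.
Proof.
split=> [gp|->].
  apply: (base_separated (b := U)) => n.
  by have [e e0] := uball_base n; apply; apply: gauge_lt; rewrite gp.
apply/eqP; rewrite eq_le gauge_ge0 andbT; apply/ler_addgt0Pr => e e0.
by rewrite add0r; apply: gauge_le => //; exact: uball0.
Qed.

Lemma gaugeZ (l : R) p : `|l| <= 1 -> gauge (l *: p) <= gauge p.
Proof.
move=> l1; apply: lb_le_inf; first by case: (gauge_has_inf p).
by move=> e [e0 ep]; apply: gauge_le => //; exact: uballZ.
Qed.

Lemma gaugeD p q : gauge (p + q) <= gauge p + gauge q.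
Proof.
apply/ler_addgt0Pr => e e0; apply: gauge_le.
  by rewrite ltr_wpDl// addr_ge0// gauge_ge0.
have -> : gauge p + gauge q + e = (gauge p + e / 2) + (gauge q + e / 2) by lra.
by apply: uballD; apply: gauge_lt; rewrite ltrDl divr_gt0.
Qed.

Definition gauge_Fnorm : Fnorm V := FNorm gauge_ge0 gauge_eq0 gaugeZ gaugeD.

End translation_space.

(** * Distance distribution functions *)

Section ddf.
Variable R : realType.

Lemma ddf_eq (F G : ddf R) : F =1 G -> F = G.
Proof.
case: F G => [f ? ? ? ? ?] [g ? ? ? ? ?] /= /funext fg.
by subst g; congr DDF; exact: Prop_irrelevance.
Qed.

Lemma ddf_npos (F : ddf R) x : (x <= 0)%E -> F x = 0.
Proof.
move=> x0; apply/eqP; rewrite eq_le; have /andP[-> _] := ddf_itv F x.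
by rewrite -(ddf_0 F) ddf_nondecreasing.
Qed.

Lemma ddf_le_eps0 (F : ddf R) : ddf_le F (eps 0%:nng).
Proof.
move=> x /=; rewrite /eps_fun /=; case: ifPn => [/ddf_npos->//|_].
by case/andP: (ddf_itv F x).
Qed.

End ddf.

(** * The strong neighborhoods of the null vector *)

Lemma exists_inv_nat_le (R : realType) (t : R) :
  0 < t -> exists n : nat, n.+1%:R^-1 <= t.
Proof.
move=> t0; exists (Num.truncn t^-1).
by rewrite -[leRHS]invrK lef_pV2 ?posrE ?invr_gt0// ltW// truncnS_gt.
Qed.

Section strong_neighborhoods.
Variables (R : realType) (V : lmodType R) (nu : pn_space V).

(** By (N4), [nu p <= taustar (nu (l *: p)) (nu ((1 - l) *: p))], and replacing
    the second argument by the identity [eps 0] above it leaves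
    [nu (l *: p)]. *)
Lemma nu_scale (l : R) p : `|l| <= 1 -> ddf_le (nu p) (nu (l *: p)).
Proof.
wlog l0 : l / 0 <= l => [hw l1|].
  have [/hw|/ltW l0] := leP 0 l; first exact.
  rewrite -[l]opprK scaleNr pn_N2; apply: hw; rewrite ?oppr_ge0//.
  by rewrite normrN.
rewrite ger0_norm// => l1 x.
have l01 : 0 <= l <= 1 by rewrite l0.
apply: le_trans (pn_N4 nu p l01 x) _.
rewrite -[X in _ <= ddf_fun X x](tf1 (pn_taustar nu)).
by apply: tf_le_r; exact: ddf_le_eps0.
Qed.

Lemma Ntheta_le s t : s <= t -> Ntheta nu s `<=` Ntheta nu t.
Proof.
move=> st p; rewrite /Ntheta /=.
have : nu p s%:E <= nu p t%:E by rewrite ddf_nondecreasing ?lee_fin.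
by lra.
Qed.

Lemma Ntheta0 t : 0 < t -> Ntheta nu t 0.
Proof.
move=> t0; rewrite /Ntheta /= (pn_N1 nu 0).2//= /eps_fun lee_fin leNgt t0 /=.
by lra.
Qed.

Lemma Ntheta_balanced t (l : R) p :
  `|l| <= 1 -> Ntheta nu t p -> Ntheta nu t (l *: p).
Proof. by move=> l1 /= tp; exact: lt_le_trans tp (nu_scale p l1 _). Qed.

(** Monotonicity turns [nu p t > 1 - t] for all small [t] into [nu p x = 1] for
    all [x > 0], that is, [nu p = eps 0]. *)
Lemma Ntheta_separated p : (forall t, 0 < t -> Ntheta nu t p) -> p = 0.
Proof.
move=> Np; apply/(pn_N1 nu); apply: ddf_eq => x; apply/eqP.
rewrite eq_le ddf_le_eps0 /= /eps_fun; case: ifPn => [x0|].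
  by case/andP: (ddf_itv (nu p) x).
rewrite -ltNge => x0; apply/ler_addgt0Pr => e e0.
have [t [t0 te tx]] : exists t, [/\ 0 < t, t <= e & (t%:E <= x)%E].
  case: x x0 => [x|_|//].
    rewrite lte_fin => x0; exists (Num.min e x); rewrite lt_min e0 x0 lee_fin.
    by rewrite !ge_min !lexx orbT.
  by exists e; rewrite leey.
have := Np t t0; rewrite /Ntheta /=.
have := ddf_nondecreasing (nu p) tx; lra.
Qed.

(** * The F-norm of the strong topology *)

Hypothesis tvs_nu : is_tvs (strong_space nu).

(** Continuity of the addition at [(0, 0)]. *)
Lemma Ntheta_half s : 0 < s ->
  exists2 t, 0 < t & forall p q, Ntheta nu t p -> Ntheta nu t q ->
    Ntheta nu s (p + q).
Proof.
move=> s0; case: tvs_nu => /(_ (0, 0)) /= addC _.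
have /addC : nbhs (0 + 0 : strong_space nu) (Ntheta nu s).
  by exists s => // _ [p sp <-]; rewrite addr0 add0r.
move=> [[A B] /= [[a a0 aA] [b b0 bB]] AB].
exists (Num.min a b); first by rewrite lt_min a0.
move=> p q pab qab; apply: (AB (p, q)); split => /=.
  apply: aA; exists p; rewrite ?add0r//.
  by apply: Ntheta_le pab; rewrite ge_min lexx.
apply: bB; exists q; rewrite ?add0r//.
by apply: Ntheta_le qab; rewrite ge_min lexx orbT.
Qed.

Let U n : set V := Ntheta nu n.+1%:R^-1.

Let U0 n : U n 0. Proof. exact: Ntheta0. Qed.

Let U_decreasing m n : (m <= n)%N -> U n `<=` U m.
Proof. by move=> mn; apply: Ntheta_le; rewrite lef_pV2 ?posrE ?ler_nat. Qed.

Let U_balanced n (l : R) p : `|l| <= 1 -> U n p -> U n (l *: p).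
Proof. exact: Ntheta_balanced. Qed.

Let U_half n : exists m, forall p q, U m p -> U m q -> U n (p + q).
Proof.
have [|t t0 tn] := @Ntheta_half n.+1%:R^-1; first by [].
have [m mt] := exists_inv_nat_le t0; exists m => p q mp mq.
by apply: tn; apply: Ntheta_le mt _ _.
Qed.

Let U_separated p : (forall n, U n p) -> p = 0.
Proof.
move=> Up; apply: Ntheta_separated => t /exists_inv_nat_le[n nt].
exact: Ntheta_le nt _ (Up n).
Qed.

Definition strong_base : balanced_base V :=
  BalancedBase U0 U_decreasing U_balanced U_half U_separated.

Lemma gauge_induces_strong :
  induces_strong_topology nu (Fnorm_metric (gauge_Fnorm strong_base)).
Proof.
set g := gauge_Fnorm _; set d := Fnorm_metric g.
move=> p; apply/seteqP; split=> A.
  move=> /(@nbhs_ballP _ (metric_space d))[e /= e0 eA].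
  (* [uball (e / 2)] gives [gauge <= e / 2], hence the strict bound. *)
  have [|n nU] := @base_uball _ _ strong_base (e / 2).
    by rewrite divr_gt0.
  exists n.+1%:R^-1 => //= _ [q Uq <-]; apply: eA.
  rewrite ballEmdist /=.
  rewrite [mdist _ _](metric_symmetric d p (p + q)) /= /d /= addrAC subrr add0r.
  have e2 : e / 2 < e by rewrite ltr_pdivrMr// ltr_pMr// ltr1n.
  apply: le_lt_trans e2; apply: gauge_le; first by rewrite divr_gt0.
  exact: nU.
move=> [t t0 tA]; have [n nt] := exists_inv_nat_le t0.
have [e e0 eU] := uball_base strong_base n.
apply/(@nbhs_ballP _ (metric_space d)); exists e => //= q.
rewrite ballEmdist /=.
rewrite [mdist _ _](metric_symmetric d p q) /= => dpq.
apply: tA; exists (q - p); last by rewrite addrC subrK.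
by apply: Ntheta_le nt _ _; apply/eU/gauge_lt.
Qed.

(** Continuity of the operations only involves the neighborhoods. *)
Lemma is_tvs_metric (d : metric V) :
  induces_strong_topology nu d -> is_tvs (metric_space d).
Proof.
move=> dnu; case: tvs_nu => cD cZ; split=> -[x y] /=.
  move=> A; rewrite /= dnu => /(cD (x, y)).
  by rewrite /nbhs /= /filter_prod /= !dnu.
move=> A; rewrite /= dnu => /(cZ (x, y)).
by rewrite /nbhs /= !dnu.
Qed.

End strong_neighborhoods.

Theorem theorem4p5 (R : realType) (V : lmodType R) (nu : pn_space V) :
  strongly_metrizable nu ->
  is_tvs (strong_space nu) ->
  exists g : Fnorm V,
    paranormed g /\ induces_strong_topology nu (Fnorm_metric g).
Proof.
move=> _ tvs_nu; exists (gauge_Fnorm (strong_base tvs_nu)).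
have gnu := gauge_induces_strong tvs_nu.
by split=> //; exact: is_tvs_metric tvs_nu _ gnu.
Qed.
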